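(* A subset $C$ of $\mathbb{R}^n$ is $\mathbb{B}$-convex if for every finite subset $A=\{x^{(1)},\dots,x^{(m)}\}$ of $C$ one has $$Co^{\boxplus}[A]=\Big\{\boxplus_{j\in[m],\,k\in[n_j]}\,t_{j,k}\,x^{(j)}\;:\;\boxplus_{k\in[n_j]}t_{j,k}\ge0\ \text{ for every } j\in[m],\ \ \max_{j\in[m],\,k\in[n_j]}t_{j,k}=1,\ \ n_j\in\mathbb{N},\ t_{j,k}\in\mathbb{R}\Big\}\subset C,$$ where the equality is the definition of $Co^{\boxplus}[A]$ and the inclusion in $C$ is the condition.
   Context: Notation: $\mathbb{N}=\{0,1,2,\dots\}$ and $[m]=\{1,\dots,m\}$ (with $[0]=\emptyset$). For $p\in\mathbb{N}$ let $\varphi_p(\lambda)=\lambda^{2p+1}$, a bijection of $\mathbb{R}$, and let $\phi_p:\mathbb{R}^n\to\mathbb{R}^n$ be its componentwise version. For a non-empty finite set $A\subset\mathbb{R}^n$, $Co^p(A)=\phi_p^{-1}\big(Co(\phi_p(A))\big)$, where $Co$ is the usual convex hull. For a sequence of sets $A^{(p)}\subset\mathbb{R}^n$, the Painlevé–Kuratowski upper limit $\mathrm{Ls}_{p\to\infty}A^{(p)}$ is the set of limits of convergent sequences $x^{(p_k)}\in A^{(p_k)}$ along subsequences $(p_k)$. Define $Co^\infty(A)=\mathrm{Ls}_{p\to\infty}Co^p(A)$. A set $C\subset\mathbb{R}^n$ is $\mathbb{B}$-convex when $Co^\infty(A)\subset C$ for every (non-empty) finite subset $A$ of $C$. For a finite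 family $(u_i)_{i\in I}$ of real numbers, $\boxplus_{i\in I}u_i=\lim_{p\to\infty}\big(\sum_{i\in I}u_i^{2p+1}\big)^{1/(2p+1)}$. Explicitly, for $\alpha>0$ put $\xi(\alpha)=\mathrm{Card}\{i:u_i=\alpha\}-\mathrm{Card}\{i:u_i=-\alpha\}$; the value is $0$ if $\xi\equiv 0$ (in particular for the empty family), and otherwise it is $\alpha^*$ or $-\alpha^*$ according to whether $\xi(\alpha^* )>0$ or $\xi(\alpha^* )<0$, where $\alpha^*$ is the largest $\alpha>0$ with $\xi(\alpha)\neq0$. For vectors $\boxplus$ is applied componentwise. The operation is not associative: $\boxplus_{j\in[m],\,k\in[n_j]}$ denotes the single operation applied to the whole family indexed by the pairs $(j,k)$. *)

(* Defs.v *)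
From mathcomp Require Import all_boot all_order all_algebra.
From mathcomp Require Import all_classical all_reals all_analysis.
Import Order.TTheory GRing.Theory Num.Theory.
Import numFieldNormedType.Exports.

Set Implicit Arguments.
Unset Strict Implicit.
Unset Printing Implicit Defensive.

Local Open Scope classical_set_scope.
Local Open Scope ring_scope.

Definition odd_pow (R : realType) (p : nat) (x : R) : R := x ^+ (2 * p).+1.

(* The inverse bijection of [odd_pow p]: since [powR] is only meaningful on
   nonnegative bases, the sign is extracted first. *)
Definition odd_root (R : realType) (p : nat) (x : R) : R :=
  Num.sg x * `|x| `^ ((2 * p).+1%:R^-1).

Lemma odd_powK (R : realType) (p : nat) :
  cancel (@odd_pow R p) (@odd_root R p).
Proof.
move=> x; rewrite /odd_root /odd_pow normrX sgrX -(powR_mulrn _ (normr_ge0 x)) -powRrM.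
rewrite mulfV ?pnatr_eq0 // powRr1 // exprS.
have [->|x0] := eqVneq x 0; first by rewrite sgr0 !mul0r.
by rewrite exprM sqr_sg x0 expr1n mulr1 -numEsg.
Qed.

Lemma odd_rootK (R : realType) (p : nat) :
  cancel (@odd_root R p) (@odd_pow R p).
Proof.
move=> x; rewrite /odd_root /odd_pow exprMn -(powR_mulrn _ (powR_ge0 _ _)) -powRrM.
rewrite mulVf ?pnatr_eq0 // powRr1 // exprS.
have [->|x0] := eqVneq x 0; first by rewrite sgr0 !mul0r.
by rewrite exprM sqr_sg x0 expr1n mulr1 -numEsg.
Qed.

Definition phi (R : realType) (n p : nat) (x : 'rV[R]_n) : 'rV[R]_n :=
  map_mx (@odd_pow R p) x.

Definition convex_hull (R : realType) (n : nat) (A : set 'rV[R]_n) :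
    set 'rV[R]_n :=
  smallest (@convex_set R 'rV[R]_n) A.

Definition Co (R : realType) (n p : nat) (A : set 'rV[R]_n) : set 'rV[R]_n :=
  @phi R n p @^-1` convex_hull (@phi R n p @` A).

(* Painleve-Kuratowski upper limit *)
Definition Ls (T : topologicalType) (A : nat -> set T) : set T :=
  [set z | exists (q : nat -> nat) (x : nat -> T),
    [/\ {homo q : k l / (k < l)%N},
        forall k, A (q k) (x k) &
        x @ \oo --> z]].

Definition Co_infty (R : realType) (n : nat) (A : set 'rV[R]_n) :
    set 'rV[R]_n :=
  Ls (fun p => Co p A).

Definition B_convex (R : realType) (n : nat) (C : set 'rV[R]_n) : Prop :=
  forall A : set 'rV[R]_n,
    finite_set A -> A !=set0 -> A `<=` C -> Co_infty A `<=` C.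

Definition boxplus (R : realType) (I : finType) (u : I -> R) : R :=
  limn (fun p => odd_root p (\sum_i odd_pow p (u i))).

Definition boxplus_vec (R : realType) (n : nat) (I : finType)
    (u : I -> 'rV[R]_n) : 'rV[R]_n :=
  \row_i boxplus (fun k => u k 0 i).

(* The maximum of the coefficients is taken in the extended reals, where the
   maximum of an empty family is -oo: that it equals 1 thus means that there is
   at least one coefficient and that the largest one is 1.  The family of all
   coefficients is indexed by the dependent pairs (j, k). *)
Definition Co_boxplus (R : realType) (n : nat) (A : set 'rV[R]_n) :
    set 'rV[R]_n :=
  [set z | exists (m : nat) (x : 'I_m -> 'rV[R]_n),
    [/\ injective x, range x = A &
      exists (N : 'I_m -> nat) (t : forall j : 'I_m, 'I_(N j) -> R),
        [/\ forall j, 0 <= boxplus (t j),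
            \big[Order.max/-oo%E]_(s : {j : 'I_m & 'I_(N j)})
               (t (tag s) (tagged s))%:E = 1%:E &
            z = boxplus_vec (fun s : {j : 'I_m & 'I_(N j)} =>
                  t (tag s) (tagged s) *: x (tag s))]]].

(* Main.v *)
Require Import Defs.
From mathcomp Require Import all_boot all_order all_algebra.
From mathcomp Require Import all_classical all_reals all_analysis.
From mathcomp Require Import ring lra.
Import Order.TTheory GRing.Theory Num.Theory.
Import numFieldNormedType.Exports.

(** For every finite A the set Co^oo(A) is contained in Co^boxplus[A], which is
    what B-convexity asks for ([Co_infty_sub_Co_boxplus]).

    A point z of Co^oo(A) is a limit of points whose coordinates are
    (2p+1)-th roots of l_i(s) = sum_j s_j a_ji^(2p+1), where the s_j >= 0 depend
    on p and sum to 1.  A point of Co^boxplus[A] is the limit, as p tends to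
    infinity, of the same expressions with weights s'_j = sum_k t_jk^(2p+1);
    such functions of p are called odd sums below.  So arbitrary weights s have
    to be traded for odd sums s' without changing the limits of the roots.

    The root of a sum of nonnegative terms tends to the maximum of the limits of
    the roots of the terms ([odd_root_sum_cvg]): only the limits of the roots of
    the terms matter when there is no cancellation.  Cancellation in the l_i is
    removed as follows.  Fix the sign e_i of l_i(s).  The weights s >= 0 with
    e_i l_i(s) >= 0 for all i form a polyhedral cone, and the double description
    method, which only uses ring operations and sign tests, produces generators
    g_r of this cone whose entries are odd sums ([cone_generators]): odd sums
    are stable under ring operations and have a constant sign for large p.
    Writing s = sum_r mu_r g_r with mu_r >= 0, all the quantities s_j and
    e_i l_i(s) become sums of nonnegative terms mu_r g_rj and
    mu_r e_i l_i(g_r).  Replacing mu_r by nu_r^(2p+1), where nu_r is the limit of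
    the roots of mu_r ([coefficient_limit]), keeps all limits and turns s into
    odd sums s' ([odd_sum_weights]).

    Finally, cancelling opposite bases in an odd sum leaves a list of reals
    in which the dominant element is the limit of the roots
    ([is_odd_sum_limit]).  Applied to each s'_j, this gives the coefficients t_jk:
    their boxplus is the limit of the roots of s_j, hence nonnegative, and the
    largest of all of them is 1 because the s_j sum to 1.

    Limits along subsequences are taken along an ultrafilter, which decides the
    signs e_i and makes the roots of all the mu_r converge at once. *)

Set Implicit Arguments.
Unset Strict Implicit.
Unset Printing Implicit Defensive.

Local Open Scope classical_set_scope.
Local Open Scope ring_scope.

(** * Odd powers and odd roots *)

Section OddPowers.
Variable R : realType.
Implicit Types (p : nat) (x y : R).

Lemma odd_powM p x y : odd_pow p (x * y) = odd_pow p x * odd_pow p y.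
Proof. exact: exprMn. Qed.

Lemma odd_powN p x : odd_pow p (- x) = - odd_pow p x.
Proof. by rewrite /odd_pow exprNn -signr_odd /= mul2n odd_double expr1 mulN1r. Qed.

Lemma odd_pow_ge0 p x : 0 <= x -> 0 <= odd_pow p x.
Proof. exact: exprn_ge0. Qed.

Lemma odd_pow0 p : odd_pow p (0 : R) = 0.
Proof. by rewrite /odd_pow expr0n. Qed.

Lemma odd_pow1 p : odd_pow p (1 : R) = 1.
Proof. exact: expr1n. Qed.

Lemma odd_rootM p x y : odd_root p (x * y) = odd_root p x * odd_root p y.
Proof. by apply: (can_inj (@odd_powK R p)); rewrite odd_powM !odd_rootK. Qed.

Lemma odd_rootN p x : odd_root p (- x) = - odd_root p x.
Proof. by apply: (can_inj (@odd_powK R p)); rewrite odd_powN !odd_rootK. Qed.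

Lemma odd_root0 p : odd_root p (0 : R) = 0.
Proof. by rewrite -{1}(odd_pow0 p) odd_powK. Qed.

Lemma odd_root1 p : odd_root p (1 : R) = 1.
Proof. by rewrite -{1}(odd_pow1 p) odd_powK. Qed.

Lemma odd_root_powR p x : 0 <= x -> odd_root p x = x `^ ((2 * p).+1%:R^-1).
Proof.
move=> x0; rewrite /odd_root ger0_norm//.
have [->|xn0] := eqVneq x 0; last by rewrite gtr0_sg ?mul1r // lt_def xn0.
by rewrite sgr0 mul0r powR0// invr_eq0 pnatr_eq0.
Qed.

Lemma odd_root_ge0 p x : 0 <= x -> 0 <= odd_root p x.
Proof. by move=> x0; rewrite odd_root_powR// powR_ge0. Qed.

Lemma ler_odd_root p x y : 0 <= x -> x <= y -> odd_root p x <= odd_root p y.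
Proof.
move=> x0 xy; have y0 := le_trans x0 xy.
by rewrite !odd_root_powR//; apply: ge0_ler_powR; rewrite ?nnegrE.
Qed.

End OddPowers.

(** * Limits of odd roots and of odd powers *)

Section RootLimits.
Variable R : realType.

(** The exponent 1 / (2p+1) tends to 0, so a factor with a positive limit
    does not change the limit of the roots. *)
Lemma odd_root_cvg1 (f : nat -> R) (c : R) : 0 < c ->
  f @ \oo --> c -> odd_root p (f p) @[p --> \oo] --> (1 : R).
Proof.
move=> c0 fc.
have f0 : \forall p \near \oo, 0 < f p by exact: (cvgr_gt c).
have root_exp : \forall p \near \oo,
    expR ((2 * p).+1%:R^-1 * ln (f p)) = odd_root p (f p).
  near=> p; have fp0 : 0 < f p by near: p.
  by rewrite odd_root_powR ?ltW// /powR gt_eqF.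
apply: cvg_trans (near_eq_cvg root_exp) _.
suff : expR ((2 * p).+1%:R^-1 * ln (f p)) @[p --> \oo] --> expR (0 * ln c).
  by rewrite mul0r expR0.
apply: continuous_cvg; first exact: continuous_expR.
apply: cvgM; last first.
  by apply: continuous_cvg => //; exact: continuous_ln.
  exact: (cvg_comp _ _ (@cvg_mulnl 2 isT) (@cvg_harmonic R)).
Unshelve. all: end_near. Qed.

Lemma odd_pow_cvg (u : R) : `|u| <= 1 -> u != -1 ->
  odd_pow p u @[p --> \oo] --> ((u == 1)%:R : R).
Proof.
move=> u1 uN1; have [->|u_neq1] := eqVneq u 1.
  by under eq_cvg do rewrite odd_pow1; exact: cvg_cst.
have {}u1 : `|u| < 1.
  by rewrite lt_neqAle u1 andbT eqr_norml negb_and negb_or u_neq1 uN1.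
apply: (@cvg_comp _ _ _ (fun p => (2 * p).+1) (GRing.exp u) _ \oo).
  exact: (cvg_comp _ _ (@cvg_mulnl 2 isT) (cvg_addnl 1)).
exact: cvg_expr.
Qed.

End RootLimits.

(** * Odd sums *)

Section SignedSums.
Variable R : realType.
Implicit Types (l : seq R) (t u : R) (f g : nat -> R).

(** Since the exponent is odd, a negative entry accounts for a negative term;
    this is an element of the group ring of the positive reals with integer
    coefficients, seen as a function of p. *)
Definition odd_sum l (p : nat) : R := \sum_(t <- l) odd_pow p t.

Definition is_odd_sum f := exists l, f =1 odd_sum l.

Lemma is_odd_sum_pow t : is_odd_sum (fun p => odd_pow p t).
Proof. by exists [:: t] => p; rewrite /odd_sum big_seq1. Qed.

Lemma is_odd_sum_cst0 : is_odd_sum (fun=> 0).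
Proof. by exists [::] => p; rewrite /odd_sum big_nil. Qed.

Lemma is_odd_sumD f g :
  is_odd_sum f -> is_odd_sum g -> is_odd_sum (fun p => f p + g p).
Proof. by move=> [l fl] [k gk]; exists (l ++ k) => p; rewrite fl gk /odd_sum big_cat. Qed.

Lemma is_odd_sumN f : is_odd_sum f -> is_odd_sum (fun p => - f p).
Proof.
move=> [l fl]; exists [seq - t | t <- l] => p; rewrite fl /odd_sum big_map -sumrN.
by apply: eq_bigr => t _; rewrite odd_powN.
Qed.

Lemma is_odd_sumM f g :
  is_odd_sum f -> is_odd_sum g -> is_odd_sum (fun p => f p * g p).
Proof.
move=> [l fl] [k gk]; exists [seq t * u | t <- l, u <- k] => p.
rewrite fl gk /odd_sum big_allpairs_dep big_distrlr /=.
by apply: eq_bigr => t _; apply: eq_bigr => u _; rewrite odd_powM.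
Qed.

Lemma is_odd_sum_sum (I : Type) (r : seq I) (F : I -> nat -> R) :
  (forall i, is_odd_sum (F i)) -> is_odd_sum (fun p => \sum_(i <- r) F i p).
Proof.
move=> Fs; elim: r => [|i r IH].
  by have [l e] := is_odd_sum_cst0; exists l => p; rewrite big_nil; exact: e.
by have [l e] := is_odd_sumD (Fs i) IH; exists l => p; rewrite big_cons; exact: e.
Qed.

(** Cancel pairs of opposite bases as long as there are any.  The condition on
    the result also excludes 0, which is its own opposite. *)
Lemma odd_sum_reduce l : exists l' : seq R,
  odd_sum l =1 odd_sum l' /\ {in l', forall t, - t \notin l'}.
Proof.
have [m] := ubnP (size l); elim: m l => // m IH l; rewrite ltnS => lm.
have [/allP red|] := boolP (all (fun t => - t \notin l) l); first by exists l.
case/allPn => t tl; rewrite negbK => Ntl.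
have [t0|t0] := eqVneq t 0.
  have [|l' [e l'red]] := IH (rem t l).
    by rewrite size_rem// (leq_trans _ lm)// prednK//; case: (l) tl.
  exists l'; split=> // p.
  by rewrite -e /odd_sum (big_rem t)//= t0 odd_pow0 add0r.
have Ntl' : - t \in rem t l.
  have : - t \in t :: rem t l by rewrite -(perm_mem (perm_to_rem tl)).
  by rewrite inE eq_sym -addr_eq0 -mulr2n mulrn_eq0 (negbTE t0).
have [|l' [e l'red]] := IH (rem (- t) (rem t l)).
  rewrite !size_rem// (leq_trans _ lm)//; case: (l) tl => //= a s _.
  by rewrite ltnS leq_pred.
exists l'; split=> // p.
by rewrite -e /odd_sum (big_rem t)//= (big_rem (- t))//= odd_powN addNKr.
Qed.

(** Dividing by t reduces to a list of reals in (-1, 1] that contains 1; the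
    sum of their odd powers tends to the number of occurrences of 1. *)
Lemma odd_root_dominant l t : t \in l -> t != 0 -> - t \notin l ->
  {in l, forall u, `|u| <= `|t|} ->
  odd_root p (odd_sum l p) @[p --> \oo] --> t.
Proof.
move=> tl t0 Ntl tmax.
have scale p : t * odd_root p (odd_sum [seq u / t | u <- l] p) =
    odd_root p (odd_sum l p).
  rewrite -{1}(odd_powK p t) -odd_rootM /odd_sum big_map big_distrr /=.
  congr odd_root; apply: eq_bigr => u _.
  by rewrite -odd_powM mulrC mulfVK.
under eq_cvg do rewrite -scale.
suff : odd_root p (odd_sum [seq u / t | u <- l] p) @[p --> \oo] --> (1 : R).
  by move=> /(cvgM (cvg_cst t)); rewrite mulr1.
pose c : R := \sum_(u <- l) (u / t == 1)%:R.
apply: (@odd_root_cvg1 _ _ c).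
  rewrite /c (big_rem t)//= divff// eqxx.
  by apply: ltr_pwDl; [exact: ltr01|apply: sumr_ge0 => u _; exact: ler0n].
have sumE : \forall p \near \oo, \sum_(u <- l | (u \in l) && true) odd_pow p (u / t) =
    odd_sum [seq u / t | u <- l] p.
  by apply: nearW => p; rewrite /odd_sum big_map [RHS]big_seq_cond.
apply: cvg_trans (near_eq_cvg sumE) _.
rewrite /c big_seq_cond; apply: cvg_big; first exact: add_continuous.
move=> u /andP[ul _]; apply: odd_pow_cvg.
  by rewrite normrM normfV ler_pdivrMr ?normr_gt0// mul1r tmax.
by apply: contraNneq Ntl => /(congr1 ( *%R^~ t)); rewrite mulfVK// mulN1r => <-.
Qed.

(** In a list without opposite entries an entry of largest modulus dominates.
    The same list carries both the values of f and the limit of its roots, so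
    that it can serve as a family of coefficients. *)
Lemma is_odd_sum_limit f : is_odd_sum f -> exists l, f =1 odd_sum l /\
  (l = [::] \/ exists2 t, t \in l & [/\ t != 0, {in l, forall u, `|u| <= `|t|}
                & odd_root p (f p) @[p --> \oo] --> t]).
Proof.
move=> [l0 fl0]; have [l [e lred]] := odd_sum_reduce l0.
have fl p : f p = odd_sum l p by rewrite fl0 e.
exists l; split=> //; have [->|l_neq0] := eqVneq l [::]; [by left|right].
have : exists2 t, t \in l & {in l, forall u, `|u| <= `|t|}.
  elim: (l) l_neq0 => [/eqP[]//|a [_ _|b s IH _]].
    by exists a => [|u]; rewrite inE // => /eqP ->.
  have [t ts tmax] := IH isT.
  have [ta|at_] := leP `|a| `|t|.
    by exists t => [|u]; rewrite in_cons ?ts ?orbT// => /predU1P[->|/tmax].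
  exists a => [|u]; rewrite in_cons ?eqxx// => /predU1P[->//|/tmax ut].
  exact: le_trans ut (ltW at_).
move=> [t tl tmax].
have t0 : t != 0.
  by apply/eqP => t0; have := lred _ tl; rewrite t0 oppr0 -{1}t0 tl.
exists t => //; split=> //; under eq_cvg do rewrite fl.
by apply: odd_root_dominant => //; exact: lred.
Qed.

(** A nonzero limit of the roots has the sign of f for large p; the limit is
    zero only when f is. *)
Lemma is_odd_sum_sign f : is_odd_sum f ->
  (\forall p \near \oo, 0 <= f p) \/ (\forall p \near \oo, f p < 0).
Proof.
move=> /is_odd_sum_limit[l [fl [l0|[t tl [t0 _ ft]]]]].
  by left; apply: nearW => p; rewrite fl l0 /odd_sum big_nil.
have root_sgr p : Num.sg (odd_root p (f p)) = Num.sg (f p).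
  rewrite -{2}(odd_rootK p (f p)) /odd_pow sgrX exprS.
  have [->|x0] := eqVneq (odd_root p (f p)) 0; first by rewrite sgr0 mul0r.
  by rewrite exprM sqr_sg x0 expr1n mulr1.
have [t_gt0|t_lt0|/eqP] := ltgtP 0 t; last by rewrite eq_sym (negbTE t0).
- left; apply: filterS (cvgr_gt t ft 0 t_gt0) => p.
  by rewrite -sgr_gt0 root_sgr sgr_gt0 => /ltW.
- right; apply: filterS (cvgr_lt t ft 0 t_lt0) => p.
  by rewrite -sgr_lt0 root_sgr sgr_lt0.
Qed.

End SignedSums.

(** * Generators of polyhedral cones *)

Section DoubleDescription.
Variable R : realType.

Definition dot m (h g : 'I_m -> R) : R := \sum_j h j * g j.

Lemma dot_lincomb m (I : finType) (h : 'I_m -> R) (c : I -> R) (g : I -> 'I_m -> R) :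
  dot h (fun j => \sum_r c r * g r j) = \sum_r c r * dot h (g r).
Proof.
rewrite /dot; under eq_bigr do rewrite big_distrr /=.
rewrite exchange_big /=; apply: eq_bigr => r _; rewrite big_distrr /=.
by apply: eq_bigr => j _; rewrite mulrCA.
Qed.

(** One step of the double description method: the generators of the
    intersection of the cone spanned by the g_r with a half-space, where h r is
    the value on g_r of the linear form that defines the half-space and b r
    records that this value is nonnegative.  Useless indices yield the zero
    vector, which keeps the index type independent of the signs. *)
Definition cut_gen (I : finType) (J : Type) (b : pred I) (h : I -> R)
    (g : I -> J -> R) (x : I + I * I) (j : J) : R :=
  match x with
  | inl r => if b r then g r j else 0
  | inr (r, q) => if b r && ~~ b q then h r * g q j - h q * g r j else 0
  end.

Lemma dot_cut_gen (I : finType) m (b : pred I) (h : I -> R) (g : I -> 'I_m -> R)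
    (e : 'I_m -> R) x :
  dot e (cut_gen b h g x) = cut_gen b h (fun r (_ : unit) => dot e (g r)) x tt.
Proof.
have dot0 : dot e (fun=> 0) = 0 by apply: big1 => j _; rewrite mulr0.
rewrite /cut_gen; case: x => [r|[r q]]; first by case: ifP.
case: ifP => // _; rewrite /dot !big_distrr -sumrB /=.
by apply: eq_bigr => j _; ring.
Qed.

Section Cut.
Variables (I : finType) (J : Type) (b : pred I) (h : I -> R) (g : I -> J -> R).
Hypothesis h_ge0 : forall r, b r -> 0 <= h r.
Hypothesis h_lt0 : forall r, ~~ b r -> h r < 0.

Lemma cut_gen_ge0 x j : (forall r, 0 <= g r j) -> 0 <= cut_gen b h g x j.
Proof.
move=> g0; case: x => [r|[r q]] /=; case: ifP => // /andP[br bq].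
by rewrite -mulNr addr_ge0// mulr_ge0// ?h_ge0// oppr_ge0 ltW// h_lt0.
Qed.

Lemma cut_gen_self x : 0 <= cut_gen b h (fun r (_ : unit) => h r) x tt.
Proof.
case: x => [r|[r q]] /=; first by case: ifP => // /h_ge0.
by rewrite mulrC subrr if_same.
Qed.

(** Let P and N be the contributions of the generators inside and outside the
    half-space to the value of the linear form, so that P + N >= 0.  The outside
    part is compensated by the fraction - N / P of the inside part, and the two
    together are a nonnegative combination of the mixed generators. *)
Lemma cut_cone (mu : I -> R) : (forall r, 0 <= mu r) -> 0 <= \sum_r mu r * h r ->
  exists mu' : I + I * I -> R, (forall x, 0 <= mu' x) /\
    forall j, \sum_r mu r * g r j = \sum_x mu' x * cut_gen b h g x j.
Proof.
move=> mu0; rewrite (bigID b) /=.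
set P := \sum_(r | b r) _; set N := \sum_(r | ~~ b r) _ => PN.
have P0 : 0 <= P by apply: sumr_ge0 => r br; rewrite mulr_ge0// h_ge0.
have N0 : N <= 0 by apply: sumr_le0 => r br; rewrite mulr_ge0_le0// ltW// h_lt0.
exists (fun x => match x with
  | inl r => (1 + N / P) * mu r
  | inr (r, q) => mu r * mu q / P
  end); split.
  case=> [r|[r q]]; last by rewrite divr_ge0// mulr_ge0.
  (* 1 + N / P is (P + N) / P; if P = 0, then N / P = 0. *)
  rewrite mulr_ge0//; have [->|Pn0] := eqVneq P 0.
    by rewrite invr0 mulr0 addr0.
  by rewrite -(mulfV Pn0) -mulrDl divr_ge0.
move=> j; rewrite big_sumType /= [LHS](bigID b) /=.
set S := \sum_(r | b r) _; set T := \sum_(r | ~~ b r) _.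
have -> : \sum_r (1 + N / P) * mu r * (if b r then g r j else 0) = (1 + N / P) * S.
  rewrite /S big_distrr [RHS]big_mkcond /=; apply: eq_bigr => r _.
  by case: ifP; rewrite ?mulr0// mulrA.
have -> : \sum_(x : I * I) (let (r, q) := x in mu r * mu q / P) *
    (let (r, q) := x in if b r && ~~ b q then h r * g q j - h q * g r j else 0) =
    P / P * T - N / P * S.
  have -> : P / P * T - N / P * S = P^-1 * (P * T - S * N) by ring.
  set iP := P^-1.
  rewrite /P /T /S /N !big_distrlr /= -sumrB big_distrr /=.
  under [RHS]eq_bigr do rewrite -sumrB big_distrr /=.
  rewrite pair_big /= [RHS]big_mkcond /=; apply: eq_bigr => -[r q] _ /=.
  by case: ifP; rewrite ?mulr0// => _; ring.
have [Pz|Pn0] := eqVneq P 0; last by rewrite divff//; ring.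
(* If P = 0, then N = 0 as well, and the outside generators have zero weight. *)
suff -> : T = 0 by ring.
have N_eq0 : N = 0 by lra.
apply: big1 => q bq; suff -> : mu q = 0 by rewrite mul0r.
have /eqP : mu q * - h q = 0.
  have sum0 : \sum_(r | ~~ b r) mu r * - h r = 0.
    by under eq_bigr do rewrite mulrN; rewrite sumrN -/N N_eq0 oppr0.
  apply/eqP; move/eqP : sum0; rewrite psumr_eq0 => [|r br]; last first.
    by rewrite mulr_ge0// oppr_ge0 ltW// h_lt0.
  by move=> /allP /(_ q); rewrite mem_index_enum bq => /(_ isT) /implyP; exact.
by rewrite mulf_eq0 oppr_eq0 (lt_eqF (h_lt0 bq)) orbF => /eqP.
Qed.

End Cut.

(** The entries of the generators stay odd sums along the induction on the
    constraints, because a step takes products and differences only; and the sign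
    tests have an outcome that does not depend on p for large p. *)
Lemma cone_generators m (O : eqType) (H : O -> nat -> 'I_m -> R) (S : seq O) :
  (forall o j, is_odd_sum (fun p => H o p j)) ->
  exists (I : finType) (g : I -> nat -> 'I_m -> R),
  [/\ forall r j, is_odd_sum (fun p => g r p j),
      \forall p \near \oo, forall r, (forall j, 0 <= g r p j) /\
        {in S, forall o, 0 <= dot (H o p) (g r p)} &
      \forall p \near \oo, forall s : 'I_m -> R, (forall j, 0 <= s j) ->
        {in S, forall o, 0 <= dot (H o p) s} ->
        exists mu : I -> R, (forall r, 0 <= mu r) /\
          forall j, s j = \sum_r mu r * g r p j].
Proof.
move=> Hsum; elim: S => [|o S [I [g [gsum gpos gspan]]]].
  exists 'I_m, (fun r _ j => (r == j)%:R); split.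
  - move=> r j; case: (r == j); last exact: is_odd_sum_cst0.
    by have [l e] := is_odd_sum_pow (1 : R); exists l => p; rewrite -e odd_pow1.
  - by apply: nearW => p r; split=> // j; exact: ler0n.
  - apply: nearW => p s s0 _; exists s; split=> // j.
    rewrite (bigD1 j)//= eqxx mulr1 big1 ?addr0// => r /negbTE ->.
    by rewrite mulr0.
have dot_sum r : is_odd_sum (fun p => dot (H o p) (g r p)).
  by apply: is_odd_sum_sum => j; exact: is_odd_sumM.
pose b r := `[< \forall p \near \oo, 0 <= dot (H o p) (g r p) >].
have signs : \forall p \near \oo, forall r,
    if b r then 0 <= dot (H o p) (g r p) else dot (H o p) (g r p) < 0.
  apply: filter_forall => r; have [br|/asboolPn br] := boolP (b r).
    by move/asboolP : br.
  by have [//|] := is_odd_sum_sign (dot_sum r).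
pose h p r := dot (H o p) (g r p).
exists (I + I * I)%type, (fun x p => cut_gen b (h p) (fun r => g r p) x).
have h_ge0 p : (forall r, if b r then 0 <= h p r else h p r < 0) ->
    forall r, b r -> 0 <= h p r.
  by move=> sgn r br; have := sgn r; rewrite br.
have h_lt0 p : (forall r, if b r then 0 <= h p r else h p r < 0) ->
    forall r, ~~ b r -> h p r < 0.
  by move=> sgn r /negbTE br; have := sgn r; rewrite br.
split.
- case=> [r|[r q]] j /=; first by case: (b r); [exact: gsum|exact: is_odd_sum_cst0].
  case: (_ && _); last exact: is_odd_sum_cst0.
  apply: is_odd_sumD; first exact: is_odd_sumM (dot_sum r) (gsum q j).
  by apply: is_odd_sumN; exact: is_odd_sumM (dot_sum q) (gsum r j).
- apply: filterS2 signs gpos => p sgn pos x; split=> [j|o'].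
    by apply: cut_gen_ge0 => [||r]; [exact: h_ge0|exact: h_lt0|apply: (pos r).1].
  rewrite in_cons dot_cut_gen => /predU1P[->|o'S].
    by apply: cut_gen_self; exact: h_ge0.
  by apply: cut_gen_ge0 => [||r]; [exact: h_ge0|exact: h_lt0|apply: (pos r).2].
- apply: filterS2 signs gspan => p sgn span s s0 sS.
  have [|mu [mu0 smu]] := span s s0.
    by move=> o' o'S; apply: sS; rewrite in_cons o'S orbT.
  have [||//||mu' [mu'0 e]] := @cut_cone I 'I_m b (h p) (fun r => g r p) _ _ mu.
  + exact: h_ge0.
  + exact: h_lt0.
  + rewrite -dot_lincomb; suff <- : s = fun j => \sum_r mu r * g r p j.
      by apply: sS; rewrite mem_head.
    exact/funext.
  + by exists mu'; split=> // j; rewrite smu e.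
Qed.

End DoubleDescription.

(** * Convex hulls of finite families *)

Section Hull.
Variable R : realType.

Lemma convex_hull_range n m (b : 'I_m -> 'rV[R]_n) (y : 'rV[R]_n) :
  convex_hull (range b) y -> exists s : 'I_m -> R,
    [/\ forall j, 0 <= s j, \sum_j s j = 1 & y = \sum_j s j *: b j].
Proof.
pose combos := [set y : 'rV[R]_n | exists s : 'I_m -> R,
  [/\ forall j, 0 <= s j, \sum_j s j = 1 & y = \sum_j s j *: b j]].
move=> hull_y; suff : combos y by [].
apply: hull_y; split=> [x1 x2 l|_ [i _ <-]].
  rewrite !inE => -[s1 [s1_ge0 s1_sum ->]] [s2 [s2_ge0 s2_sum ->]].
  set z := (X in combos X).
  have -> : z = l%:num *: (\sum_j s1 j *: b j) +
    (1 - l%:num) *: (\sum_j s2 j *: b j) by [].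
  exists (fun j => l%:num * s1 j + (1 - l%:num) * s2 j); split=> [j||].
  - by rewrite addr_ge0// mulr_ge0.
  - by rewrite big_split -!big_distrr /= s1_sum s2_sum !mulr1 addrC subrK.
  - rewrite !scaler_sumr -big_split; apply: eq_bigr => j _.
    by rewrite [LHS]/= !scalerA scalerDl.
exists (fun j => (j == i)%:R); split=> [j||]; first exact: ler0n.
- by rewrite (bigD1 i)//= eqxx big1 ?addr0// => j /negbTE ->.
- by rewrite (bigD1 i)//= eqxx scale1r big1 ?addr0// => j /negbTE ->; rewrite scale0r.
Qed.

End Hull.

(** * Limits along an ultrafilter *)

Section Limits.
Variables (R : realType) (T : Type).
Implicit Types (q : T -> nat).

Lemma ultra_cvg_segment (U : set_system T) (f : T -> R) (a b : R) :
  UltraFilter U -> (\forall k \near U, a <= f k <= b) ->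
  exists2 v, a <= v & f k @[k --> U] --> v.
Proof.
move=> UU fab; have [|v [vab vcl]] := @segment_compact R a b (f @ U) _.
  by apply: filterS fab => k; rewrite /= in_itv.
exists v; first by move: vab; rewrite /= in_itv /= => /andP[].
move=> B vB; have [//|UnB] := in_ultra_setVsetC (f @^-1` B) UU.
have [y [nBy By]] := vcl (~` B) B UnB vB.
by [].
Qed.

Lemma cvg_bigmax (F : set_system T) (I : finType) (f : I -> T -> R) (v : I -> R) :
  Filter F -> (forall r, f r k @[k --> F] --> v r) ->
  \big[Num.max/0]_r f r k @[k --> F] --> \big[Num.max/0]_r v r.
Proof.
move=> FF fv; apply: cvg_big => // -[x y].
exact: (@continuous_max R (R^o * R^o)%type fst snd (x, y) cvg_fst cvg_snd).
Qed.

(** The sum lies between its largest term and the number of terms times that,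
    and the roots of the latter factor tend to 1. *)
Lemma odd_root_sum_cvg (F : set_system T) q (I : finType) (f : I -> T -> R) (v : I -> R) :
  ProperFilter F -> q @ F --> \oo ->
  (\forall k \near F, forall r, 0 <= f r k) ->
  (forall r, odd_root (q k) (f r k) @[k --> F] --> v r) ->
  odd_root (q k) (\sum_r f r k) @[k --> F] --> \big[Num.max/0]_r v r.
Proof.
move=> FF qF f0 fv.
pose M k := \big[Num.max/0]_r odd_root (q k) (f r k).
have Mv : M k @[k --> F] --> \big[Num.max/0]_r v r by exact: cvg_bigmax.
pose N : R := #|I|.+1%:R.
have rootN : odd_root (q k) N @[k --> F] --> (1 : R).
  apply: (cvg_comp _ (fun p => odd_root p N) qF).
  by apply: (@odd_root_cvg1 _ _ N); [exact: ltr0Sn|exact: cvg_cst].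
apply: (@squeeze_cvgr _ _ _ _ M (fun k => odd_root (q k) N * M k)) => //; last first.
  by have := cvgM rootN Mv; rewrite mul1r; exact.
apply: filterS f0 => k f0; apply/andP; split.
  apply: bigmax_le => [|r _]; first by rewrite odd_root_ge0// sumr_ge0.
  by rewrite ler_odd_root// (bigD1 r)//= lerDl sumr_ge0.
have M0 : 0 <= M k by exact: bigmax_ge_id.
rewrite -(odd_powK (q k) (M k)) -odd_rootM; apply: ler_odd_root.
  exact: sumr_ge0.
apply: (@le_trans _ _ (\sum_(r : I) odd_pow (q k) (M k))).
  apply: ler_sum => r _; rewrite -{1}(odd_rootK (q k) (f r k)).
  apply: lerXn2r; rewrite ?nnegrE ?odd_root_ge0//.
  exact: (le_bigmax 0 (fun r => odd_root (q k) (f r k))).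
(* The factor #|I| + 1 instead of #|I| is positive even when I is empty. *)
rewrite sumr_const -mulr_natl ler_wpM2r ?odd_pow_ge0// ler_nat.
by rewrite leqnSn.
Qed.

Lemma is_odd_sum_cvg (f : nat -> R) : is_odd_sum f ->
  exists w, odd_root p (f p) @[p --> \oo] --> (w : R).
Proof.
move=> /is_odd_sum_limit[l [fl [l0|[t _ [_ _ ft]]]]]; last by exists t.
exists 0; suff -> : (fun p => odd_root p (f p)) = fun=> 0 by exact: cvg_cst.
by apply/funext => p; rewrite fl l0 /odd_sum big_nil odd_root0.
Qed.

(** The number nu is the limit of the roots of mu k, which are bounded because
    some entry of g has roots with a positive limit.  If no entry has, all the
    entries vanish identically; then mu k may be unbounded, and nu = 0 is
    taken.  The conclusion covers the entries of g and the values of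
    linear forms on g at once: both are odd sums that vanish together with g. *)
Lemma coefficient_limit (U : set_system T) q m (g : nat -> 'I_m -> R) (mu : T -> R) :
  UltraFilter U -> q @ U --> \oo ->
  (forall j, is_odd_sum (fun p => g p j)) ->
  (\forall k \near U, 0 <= mu k) ->
  (\forall k \near U, forall j, 0 <= g (q k) j /\ mu k * g (q k) j <= 1) ->
  exists2 nu : R, 0 <= nu & forall f : nat -> R, is_odd_sum f ->
    (forall p, (forall j, g p j = 0) -> f p = 0) ->
    exists2 v : R, odd_root (q k) (mu k * f (q k)) @[k --> U] --> v &
      odd_root p (odd_pow p nu * f p) @[p --> \oo] --> v.
Proof.
move=> UU qU gsum mu0 mug.
have [[j [t t0 gt]]|nog] := pselect (exists j, exists2 t : R, t != 0 &
    odd_root p (g p j) @[p --> \oo] --> t); last first.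
  exists 0 => // f fsum gf0; have f0 p : f p = 0.
    apply: gf0 => j; have [l [-> [->|]]] := is_odd_sum_limit (gsum j).
      by rewrite /odd_sum big_nil.
    by case=> t _ [t0 _ gt]; case: nog; exists j, t.
  exists 0.
    by under eq_cvg do rewrite f0 mulr0 odd_root0; exact: cvg_cst.
  by under eq_cvg do rewrite f0 mulr0 odd_root0; exact: cvg_cst.
have gtU : odd_root (q k) (g (q k) j) @[k --> U] --> t.
  exact: (cvg_comp _ (fun p => odd_root p (g p j)) qU).
have t_gt0 : 0 < t.
  rewrite lt_def t0 /=; apply: cvgr_to_ge gtU _.
  apply: filterS mug => k mug; apply: odd_root_ge0; exact: (mug j).1.
have [|nu nu0 munu] := @ultra_cvg_segment U (fun k => odd_root (q k) (mu k)) 0 (2 / t) UU.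
  have t2 : t / 2 < t by lra.
  apply: filterS3 mu0 mug (cvgr_gt t gtU (t / 2) t2) => k mu0 mug gt2.
  rewrite odd_root_ge0//= ler_pdivlMr//.
  have : odd_root (q k) (mu k) * odd_root (q k) (g (q k) j) <= 1.
    rewrite -odd_rootM -(odd_root1 R (q k)); apply: ler_odd_root; last exact: (mug j).2.
    by rewrite mulr_ge0//; exact: (mug j).1.
  have := odd_root_ge0 (q k) mu0; nra.
exists nu => // f fsum _; have [w fw] := is_odd_sum_cvg fsum.
exists (nu * w).
  under eq_cvg do rewrite odd_rootM.
  apply: cvgM => //; exact: (cvg_comp _ (fun p => odd_root p (f p)) qU).
under eq_cvg do rewrite odd_rootM odd_powK.
by apply: cvgM => //; exact: cvg_cst.
Qed.

End Limits.

(** * Replacing the weights by odd sums *)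

Section Main.
Variable R : realType.

Lemma odd_pow_sign p (b : bool) (x : R) :
  odd_pow p ((-1) ^+ b * x) = (-1) ^+ b * odd_pow p x.
Proof. by case: b; rewrite ?expr1 ?mulN1r ?odd_powN// expr0 !mul1r. Qed.

Lemma odd_root_sign p (b : bool) (x : R) :
  odd_root p ((-1) ^+ b * x) = (-1) ^+ b * odd_root p x.
Proof. by case: b; rewrite ?expr1 ?mulN1r ?odd_rootN// expr0 !mul1r. Qed.

Lemma odd_sum_ord (l : seq R) p :
  \sum_(k < size l) odd_pow p (nth 0 l k) = odd_sum l p.
Proof. by rewrite /odd_sum (big_nth 0) big_mkord. Qed.

(** The limit w j is common to the roots of s k j and of the new weight s' j:
    this is where the nonnegativity of w and the value of its maximum come
    from. *)
Lemma odd_sum_weights n m (a : 'I_m -> 'rV[R]_n) (U : set_system nat)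
    (q : nat -> nat) (s : nat -> 'I_m -> R) (z : 'rV[R]_n) :
  UltraFilter U -> q @ U --> \oo ->
  (forall k j, 0 <= s k j) -> (forall k, \sum_j s k j = 1) ->
  (forall i, odd_root (q k) (\sum_j s k j * odd_pow (q k) (a j 0 i)) @[k --> U] --> z 0 i) ->
  exists (s' : 'I_m -> nat -> R) (w : 'I_m -> R),
    [/\ forall j, is_odd_sum (s' j),
        forall j, odd_root p (s' j p) @[p --> \oo] --> w j,
        forall j, 0 <= w j,
        \big[Num.max/0]_j w j = 1 &
        forall i, odd_root p (\sum_j s' j p * odd_pow p (a j 0 i)) @[p --> \oo] --> z 0 i].
Proof.
move=> UU qU s0 s1 sz.
(* The ultrafilter decides the sign of the i-th linear form. *)
have sgn_ex i : exists b : bool, \forall k \near U,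
    0 <= \sum_j s k j * odd_pow (q k) ((-1) ^+ b * a j 0 i).
  pose S k := \sum_j s k j * odd_pow (q k) (a j 0 i).
  have SE (b : bool) k : \sum_j s k j * odd_pow (q k) ((-1) ^+ b * a j 0 i) =
      (-1) ^+ b * S k.
    by rewrite big_distrr; apply: eq_bigr => j _; rewrite odd_pow_sign mulrCA.
  have [Spos|Sneg] := in_ultra_setVsetC [set k | 0 <= S k] UU.
    by exists false; apply: filterS Spos => k; rewrite SE mul1r.
  exists true; apply: filterS Sneg => k /negP; rewrite -ltNge => /ltW Sk.
  by rewrite SE mulN1r oppr_ge0.
have [b bP] := choice sgn_ex.
pose H i p j := odd_pow p ((-1) ^+ b i * a j 0 i).
have Hsum i j : is_odd_sum (fun p => H i p j) by exact: is_odd_sum_pow.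
have [I [g [gsum gpos gspan]]] := cone_generators (enum 'I_n) Hsum.
have near_q (P : nat -> Prop) : (\forall p \near \oo, P p) -> \forall k \near U, P (q k).
  by move=> /qU.
(* The generators span the weights only for U-almost all k; for the others,
   mu k is arbitrary. *)
pose decomposes k (mu : I -> R) := (forall r, 0 <= mu r) /\
  forall j, s k j = \sum_r mu r * g r (q k) j.
have /choice[mu muP] : forall k, exists mu : I -> R,
    (exists mu', decomposes k mu') -> decomposes k mu.
  move=> k.
  have [[mu' d]|nd] := pselect (exists mu', decomposes k mu'); first by exists mu'.
  by exists (fun=> 0).
have mu_dec : \forall k \near U, decomposes k (mu k).
  have s_dot : \forall k \near U, forall i, 0 <= dot (H i (q k)) (s k).
    apply: filter_forall => i; apply: filterS (bP i) => k.
    by rewrite /dot; under eq_bigr do rewrite mulrC.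
  have gspanU := near_q _ gspan.
  apply: filterS2 gspanU s_dot => k span sgn.
  by apply: muP; apply: span.
have gposU := near_q _ gpos.
have nu_ex r : exists nu : R, 0 <= nu /\ forall f : nat -> R, is_odd_sum f ->
    (forall p, (forall j, g r p j = 0) -> f p = 0) ->
    exists2 v : R, odd_root (q k) (mu k r * f (q k)) @[k --> U] --> v &
      odd_root p (odd_pow p nu * f p) @[p --> \oo] --> v.
  have [||nu nu0 nuP] := @coefficient_limit _ _ U q m (g r) (fun k => mu k r) UU qU (gsum r).
  - by apply: filterS mu_dec => k [].
  - apply: filterS2 mu_dec gposU => k [mu0 smu] pos j; split; first exact: (pos r).1.
    have : s k j <= 1 by rewrite -(s1 k) (bigD1 j)//= lerDl sumr_ge0.
    apply: le_trans; rewrite smu (bigD1 r)//= lerDl sumr_ge0// => r' _.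
    by rewrite mulr_ge0//; exact: (pos r').1.
  by exists nu.
have [nu nuP] := choice nu_ex.
(* As all terms are nonnegative, replacing mu by the powers of nu does not
   change the limit of the roots of the sum. *)
have transfer (f : I -> nat -> R) : (forall r, is_odd_sum (f r)) ->
    (\forall p \near \oo, forall r, 0 <= f r p) ->
    (forall r p, (forall j, g r p j = 0) -> f r p = 0) ->
    exists2 v : R, odd_root (q k) (\sum_r mu k r * f r (q k)) @[k --> U] --> v &
      odd_root p (\sum_r odd_pow p (nu r) * f r p) @[p --> \oo] --> v.
  move=> fsum f0 fg.
  have /choice[v vP] : forall r, exists v : R,
      odd_root (q k) (mu k r * f r (q k)) @[k --> U] --> v /\
      odd_root p (odd_pow p (nu r) * f r p) @[p --> \oo] --> v.
    move=> r.
    by have [v v1 v2] := (nuP r).2 (f r) (fsum r) (fg r); exists v.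
  exists (\big[Num.max/0]_r v r).
    apply: (odd_root_sum_cvg _ qU) => [|r]; last exact: (vP r).1.
    have f0U := near_q _ f0; apply: filterS2 mu_dec f0U => k [mu0 _] fk r.
    by rewrite mulr_ge0.
  apply: (@odd_root_sum_cvg _ _ \oo id I) => [||r]; last exact: (vP r).2.
    exact: cvg_id.
  by apply: filterS f0 => p fp r; rewrite mulr_ge0// odd_pow_ge0// (nuP r).1.
pose s' j p := \sum_r odd_pow p (nu r) * g r p j.
have w_ex j : exists w : R, odd_root (q k) (s k j) @[k --> U] --> w /\
    odd_root p (s' j p) @[p --> \oo] --> w.
  have [|||w w1 w2] := transfer (fun r p => g r p j).
  - by move=> r; exact: gsum.
  - by apply: filterS gpos => p pos r; exact: (pos r).1.
  - by move=> r p; exact.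
  exists w; split=> //; apply: cvg_trans w1; apply: near_eq_cvg.
  by apply: filterS mu_dec => k [_ ->].
have [w wP] := choice w_ex.
have dot_s' i p : dot (H i p) (s'^~ p) = \sum_r odd_pow p (nu r) * dot (H i p) (g r p).
  by rewrite -dot_lincomb.
exists s', w; split.
- move=> j; apply: is_odd_sum_sum => r; apply: is_odd_sumM; last exact: gsum.
  exact: is_odd_sum_pow.
- by move=> j; exact: (wP j).2.
- move=> j; apply: cvgr_to_ge (wP j).1 _.
  by apply: nearW => k; exact: odd_root_ge0.
- have lim1 : odd_root (q k) (\sum_j s k j) @[k --> U] --> (1 : R).
    by under eq_cvg do rewrite s1 odd_root1; exact: cvg_cst.
  apply: cvg_unique lim1; first exact: Rhausdorff.
  apply: (odd_root_sum_cvg (f := fun j k => s k j) _ qU) => [|j]; last exact: (wP j).1.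
  exact: nearW.
- move=> i; have [|||v v1 v2] := transfer (fun r p => dot (H i p) (g r p)).
  + by move=> r; apply: is_odd_sum_sum => j; apply: is_odd_sumM.
  + by apply: filterS gpos => p pos r; apply: (pos r).2; rewrite mem_enum.
  + by move=> r p g0; apply: big1 => j _; rewrite g0 mulr0.
  have sumE p (c : 'I_m -> R) : \sum_j c j * odd_pow p (a j 0 i) =
      (-1) ^+ b i * dot (H i p) c.
    rewrite /dot big_distrr; apply: eq_bigr => j _.
    by rewrite /H odd_pow_sign /= -mulrA signrMK mulrC.
  have zv : z 0 i = (-1) ^+ b i * v.
    apply: (cvg_unique (@Rhausdorff R) (sz i)).
    have lim : (-1) ^+ b i * odd_root (q k) (\sum_r mu k r * dot (H i (q k)) (g r (q k)))
      @[k --> U] --> (-1) ^+ b i * v by apply: cvgM => //; exact: cvg_cst.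
    apply: cvg_trans lim; apply: near_eq_cvg; apply: filterS mu_dec => k [_ smu].
    rewrite sumE odd_root_sign -dot_lincomb; congr (_ * odd_root _ (dot _ _)).
    by apply/funext => j; rewrite smu.
  rewrite zv; under eq_cvg do rewrite sumE odd_root_sign dot_s'.
  by apply: cvgM => //; exact: cvg_cst.
Qed.

(** The reduced list of bases of the weight s' j provides the coefficients
    t j k. *)
Lemma Co_infty_sub_Co_boxplus n m (a : 'I_m -> 'rV[R]_n) : injective a ->
  Co_infty (range a) `<=` Co_boxplus (range a).
Proof.
move=> a_inj z [q [x [q_incr xCo xz]]].
have /choice[s sP] : forall k, exists s : 'I_m -> R,
    [/\ forall j, 0 <= s j, \sum_j s j = 1 &
        phi (q k) (x k) = \sum_j s j *: phi (q k) (a j)].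
  move=> k.
  apply: convex_hull_range; have := xCo k.
  by rewrite /Co /= image_comp.
have [U [UU sU]] := @ultraFilterLemma nat \oo _.
have qoo : q @ \oo --> \oo.
  apply/cvgnyPge => A; near=> k; apply: (@leq_trans k).
    by near: k; exact: nbhs_infty_ge.
  elim: (k) => // k' IH; apply: leq_ltn_trans IH _; exact: q_incr.
have qU : q @ U --> \oo by move=> B /qoo /sU.
have sz i : odd_root (q k) (\sum_j s k j * odd_pow (q k) (a j 0 i)) @[k --> U] --> z 0 i.
  have xzi : x k 0 i @[k --> U] --> z 0 i.
    have : x k 0 i @[k --> \oo] --> z 0 i.
      apply: (@cvg_comp _ _ _ x (fun y : 'rV[R]_n => y 0 i) _ _ _ xz).
      exact: coord_continuous.
    by move=> h B /h /sU.
  apply: cvg_trans xzi; apply: near_eq_cvg; apply: nearW => k.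
  have [_ _ /rowP/(_ i)] := sP k; rewrite !mxE summxE => e.
  rewrite -(odd_powK (q k) (x k 0 i)) e; congr odd_root.
  by apply: eq_bigr => j _; rewrite !mxE.
have [||s' [w [s'sum s'w w0 wmax s'z]]] := odd_sum_weights UU qU _ _ sz.
- by move=> k; have [] := sP k.
- by move=> k; have [] := sP k.
have [l lP] := choice (fun j => is_odd_sum_limit (s'sum j)).
have l_le j t : t \in l j -> t <= 1.
  have [_ [->//|[t0 _ [_ t0max t0lim]]]] := lP j.
  have wj : w j = t0 by apply: cvg_unique (s'w j) t0lim; exact: Rhausdorff.
  move=> /t0max; rewrite -wj (ger0_norm (w0 j)) => /ler_normlW /le_trans; apply.
  by rewrite -wmax; exact: le_bigmax.
have [j0 wj0] : exists j0, w j0 = 1.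
  apply: contrapT => nw; have : \big[Num.max/0]_j w j < 1.
    apply: bigmax_lt => // j _; rewrite lt_neqAle -{2}wmax le_bigmax andbT.
    by apply/eqP => wj; apply: nw; exists j.
  by rewrite wmax ltxx.
(* The dominant element of the list of an index j0 with w j0 = 1 is 1. *)
have l_one : 1 \in l j0.
  have [s'l [l0|[t0 t0l [_ _ t0lim]]]] := lP j0.
    have : odd_root p (s' j0 p) @[p --> \oo] --> (0 : R).
      under eq_cvg do rewrite s'l l0 /odd_sum big_nil odd_root0.
      exact: cvg_cst.
    move=> /(cvg_unique (@Rhausdorff R) (s'w j0))/eqP.
    by rewrite wj0 oner_eq0.
  suff <- : t0 = 1 by [].
  by rewrite -wj0; apply: cvg_unique t0lim (s'w j0); exact: Rhausdorff.
exists m, a; split=> //.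
exists (fun j => size (l j)), (fun j (k : 'I_(size (l j))) => nth 0 (l j) k); split.
- move=> j; suff -> : boxplus (fun k : 'I_(size (l j)) => nth 0 (l j) k) = w j by [].
  rewrite /boxplus; apply: cvg_lim; first exact: Rhausdorff.
  under eq_cvg do rewrite odd_sum_ord -(lP j).1.
  exact: s'w.
- apply/le_anti/andP; split.
    apply: bigmax_le => [|[j k] _]; first by rewrite leNye.
    by rewrite lee_fin; apply: (l_le j); exact: mem_nth.
  have i1 : (index (1%R : R) (l j0) < size (l j0))%N by rewrite index_mem.
  apply: (@bigmax_sup _ _ _ _ (Tagged (fun j => 'I_(size (l j))) (Ordinal i1))) => //.
  by rewrite /= nth_index.
- apply/rowP => i; rewrite mxE; apply/esym; rewrite /boxplus.
  apply: cvg_lim; first exact: Rhausdorff.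
  apply: cvg_trans (s'z i); apply: near_eq_cvg; apply: nearW => p.
  congr odd_root; rewrite -(sig_big_dep xpredT (fun _ => xpredT)
    (fun j (k : 'I_(size (l j))) => odd_pow p ((nth 0 (l j) k *: a j) 0 i))) /=.
  apply: eq_bigr => j _; rewrite (lP j).1 -odd_sum_ord big_distrl /=.
  by apply: eq_bigr => k _; rewrite mxE odd_powM.
Unshelve. all: end_near. Qed.

End Main.

Theorem proposition3p3p5 (R : realType) (n : nat) (C : set 'rV[R]_n)
  (hC : forall A : set 'rV[R]_n,
      finite_set A -> A `<=` C -> Co_boxplus A `<=` C) :
  B_convex C.
Proof.
move=> A A_fin _ AC.
suff sub : Co_infty A `<=` Co_boxplus A by move=> z /sub; exact: hC.
have /finite_seqP[e eA] := A_fin.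
pose a (j : 'I_(size (undup e))) := nth 0 (undup e) j.
have a_inj : injective a.
  by move=> i j /eqP; rewrite nth_uniq ?undup_uniq// => /eqP/val_inj.
suff -> : A = range a by exact: Co_infty_sub_Co_boxplus.
rewrite eA; apply/seteqP; split=> [y /= ye|_ [j _ <-]]; last first.
  by rewrite /= -mem_undup mem_nth.
have yi : (index y (undup e) < size (undup e))%N by rewrite index_mem mem_undup.
by exists (Ordinal yi) => //; rewrite /a /= nth_index// mem_undup.
Qed.
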